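(* Let $N\ge 1$ and, for each $i=1,\dots,N$, let $A_i\in\mathbb{R}^{n_i\times n_i}$, $C_i\in\mathbb{R}^{p_i\times n_i}$, $Q_i\succ 0$, $R_i\succ 0$ with $(A_i,Q_i^{1/2})$ controllable and $(A_i,C_i)$ detectable, and assume $\sum_{i=1}^Nq_i^c<1$. Then the problem $$\text{OP}:\quad \min_{q_1,\dots,q_N}\ \max_{i}\ \mathrm{Tr}(X_i(q_i))\quad\text{subject to}\quad \sum_{i=1}^Nq_i=1,\quad q_i^c<q_i\le1,\ i=1,\dots,N,$$ where $X_i(q_i)\succeq0$ is the fixed point of $X_i=g_{q_i}(X_i)$, is a quasi-convex optimization problem (a quasi-convex objective function is minimized over a convex set).
   Context: For each $i$, $X\succeq0$ and $q\in[0,1]$, $$g_{q}(X)=A_iXA_i'+Q_i-q\,A_iXC_i'(C_iXC_i'+R_i)^{-1}C_iXA_i'$$ (the map for system $i$; $'$ denotes transpose). The critical value $q_i^c\in[0,1)$ depends on the unstable eigenvalues of $A_i$ and is the threshold such that, for $q_i\in(0,1]$, a positive semidefinite fixed point $X_i=g_{q_i}(X_i)$ exists if and only if $q_i>q_i^c$. It is known (earlier literature) that for $q_i\in(q_i^c,1]$ this fixed point $X_i(q_i)$ is unique and is the limit of the iterates of $g_{q_i}$ from any initial $X_0\succeq0$. A real function on a convex set is quasi-convex if all its sublevel sets are convex. *)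

(* Defs.v *)
From HB Require Import structures.
From mathcomp Require Import all_boot all_order all_algebra.
From mathcomp Require Import all_classical all_reals all_analysis.
From mathcomp.real_closed Require Import complex.

Set Implicit Arguments.
Unset Strict Implicit.
Unset Printing Implicit Defensive.

Import Order.TTheory GRing.Theory Num.Theory.

Local Open Scope classical_set_scope.
Local Open Scope ring_scope.

Section Matrices.
Variable R : realType.

Definition psdmx n (M : 'M[R]_n) : Prop :=
  M^T = M /\ forall x : 'cV[R]_n, 0 <= \tr (x^T *m M *m x).

Definition pdmx n (M : 'M[R]_n) : Prop :=
  M^T = M /\ forall x : 'cV[R]_n, x != 0 -> 0 < \tr (x^T *m M *m x).

(* A positive semidefinite M has exactly one positive semidefinite square root;
   the value is the default 0 when M has none. *)
Definition sqrtmx n (M : 'M[R]_n) : 'M[R]_n :=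
  xget 0 [set S : 'M[R]_n | psdmx S /\ S *m S = M].

(* Kalman rank condition: [B, A B, ..., A^(n-1) B] has rank n. *)
Definition controllable n m (A : 'M[R]_n) (B : 'M[R]_(n, m)) : Prop :=
  \rank (\mxrow_(k < n) (A ^+ k *m B)) = n.

(* All complex eigenvalues lie in the open unit disc (discrete time). *)
Definition schur_stable n (M : 'M[R]_n) : Prop :=
  forall z : R[i], eigenvalue (map_mx (real_complex R) M) z -> `|z| < 1.

Definition detectable n p (A : 'M[R]_n) (C : 'M[R]_(p, n)) : Prop :=
  exists L : 'M[R]_(n, p), schur_stable (A - L *m C).

End Matrices.

Section Riccati.
Variables (R : realType) (n p : nat).
Variables (A : 'M[R]_n) (C : 'M[R]_(p, n)) (Q : 'M[R]_n) (V : 'M[R]_p).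

(* V is the measurement noise covariance, usually written R. *)
Definition riccati (q : R) (X : 'M[R]_n) : 'M[R]_n :=
  A *m X *m A^T + Q
  - q *: (A *m X *m C^T *m invmx (C *m X *m C^T + V) *m C *m X *m A^T).

Definition riccati_fixpoint (q : R) (X : 'M[R]_n) : Prop :=
  psdmx X /\ X = riccati q X.

Definition is_critical_value (qc : R) : Prop :=
  0 <= qc < 1 /\
  forall q : R, 0 < q <= 1 -> (exists X, riccati_fixpoint q X) <-> qc < q.

(* Meaningful for qc < q <= 1, where the positive semidefinite fixed point
   exists and is unique; the value is the default 0 when there is none. *)
Definition riccati_sol (q : R) : 'M[R]_n := xget 0 (riccati_fixpoint q).

End Riccati.

Section QuasiConvex.
Variables (R : realType) (E : lmodType R).

Definition quasiconvex_on (S : set E) (f : E -> R) : Prop :=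
  forall a : R, convex_set [set x | S x /\ f x <= a].

(* The problem: minimize f over S. *)
Definition quasiconvex_problem (S : set E) (f : E -> R) : Prop :=
  convex_set S /\ quasiconvex_on S f.

End QuasiConvex.

Section OP.
Variables (R : realType) (N : nat) (n p : 'I_N.+1 -> nat).
Variables (A : forall i, 'M[R]_(n i)) (C : forall i, 'M[R]_(p i, n i)).
Variables (Q : forall i, 'M[R]_(n i)) (V : forall i, 'M[R]_(p i)).

Definition op_trace (q : 'rV[R]_N.+1) (i : 'I_N.+1) : R :=
  \tr (riccati_sol (A i) (C i) (Q i) (V i) (q 0 i)).

(* The index set is nonempty, so starting the iterated maximum at the entry of
   index 0 adds no extra term. *)
Definition op_objective (q : 'rV[R]_N.+1) : R :=
  \big[Num.max/op_trace q ord0]_(i < N.+1) op_trace q i.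

Definition op_feasible (qc : 'I_N.+1 -> R) : set 'rV[R]_N.+1 :=
  [set q : 'rV[R]_N.+1 | \sum_i q 0 i = 1 /\ forall i, qc i < q 0 i <= 1].

End OP.

(* Main.v *)
Require Import Defs.
From HB Require Import structures.
From mathcomp Require Import all_boot all_order all_algebra.
From mathcomp Require Import all_classical all_reals all_analysis.
From mathcomp Require Import ring lra.

Set Implicit Arguments.
Unset Strict Implicit.
Unset Printing Implicit Defensive.

(** An objective of the form max_i f_i(q_i), with each f_i nonincreasing, is
    quasi-convex on a convex set: each coordinate of a convex combination of x
    and y is at least the smaller of the corresponding coordinates of x and y,
    so f_i does not exceed there the larger of its two values
    ([min_le_convex]). The whole content is therefore that Tr X_i(q) is
    nonincreasing in q.

    Write X <= Y for the Loewner order, i.e. psdmx (Y - X). By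
    [riccati_fixpoint_antitone], if 0 <= q1 <= q2 <= 1 and X1, X2 are any positive
    semidefinite fixed points for these rates, then X2 <= X1; the case q1 = q2
    gives uniqueness, so it does not matter which fixed point the choice
    operator selects.

    For q in [0, 1], the map g_q has three properties. It decreases in q. It is monotone in X.
    It is sub-homogeneous, g_q(t X) >= t g_q(X) + (1 - t) Q for t in [0, 1],
    which is what concavity says on the segment from 0 to X. The last two come
    from writing g_q as a minimum over filter gains K of functions affine and
    monotone in X ([riccati_complete_square]); the minimum is attained at the
    Kalman gain.

    Since Q is positive definite, e X2 <= Q for some e in (0, 1]
    ([pdmx_dominates]). If t X2 <= X1, then
      X1 = g_q1(X1) >= g_q2(X1) >= g_q2(t X2) >= t X2 + (1 - t) Q
         >= (t + (1 - t) e) X2,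
    so the defect 1 - t can be multiplied by 1 - e. Starting from t = 0 and
    iterating, (1 - (1 - e)^k) X2 <= X1 for all k, and k -> oo gives
    X2 <= X1. *)

Import Order.TTheory GRing.Theory Num.Theory.

Local Open Scope ring_scope.

(** * Positive semidefinite matrices *)

Section PositiveSemidefinite.
Context {R : realType}.

Lemma psdmxD n (M P : 'M[R]_n) : psdmx M -> psdmx P -> psdmx (M + P).
Proof.
move=> [sM pM] [sP pP]; split=> [|x]; first by rewrite raddfD /= sM sP.
by rewrite mulmxDr mulmxDl raddfD /= addr_ge0.
Qed.

Lemma psdmxZ n (a : R) (M : 'M[R]_n) : 0 <= a -> psdmx M -> psdmx (a *: M).
Proof.
move=> a0 [sM pM]; split=> [|x]; first by rewrite linearZ /= sM.
by rewrite -scalemxAr -scalemxAl linearZ /= mulr_ge0.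
Qed.

Lemma psdmx_congr m n (K : 'M[R]_(m, n)) (M : 'M[R]_n) :
  psdmx M -> psdmx (K *m M *m K^T).
Proof.
move=> [sM pM]; split=> [|x]; first by rewrite !trmx_mul trmxK sM mulmxA.
by have := pM (K^T *m x); rewrite trmx_mul trmxK !mulmxA.
Qed.

Lemma pdmx_psd n (M : 'M[R]_n) : pdmx M -> psdmx M.
Proof.
move=> [sM pM]; split=> // x; have [->|x0] := eqVneq x 0.
  by rewrite mulmx0 mxtrace0.
exact/ltW/pM.
Qed.

Lemma psd_pdmxD n (M P : 'M[R]_n) : psdmx M -> pdmx P -> pdmx (M + P).
Proof.
move=> [sM pM] [sP pP]; split=> [|x x0]; first by rewrite raddfD /= sM sP.
by rewrite mulmxDr mulmxDl raddfD /= ltr_wpDl // pP.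
Qed.

Lemma pdmx_unit n (M : 'M[R]_n) : pdmx M -> M \in unitmx.
Proof.
move=> [_ pM]; rewrite -row_free_unit -kermx_eq0; apply/negPn/negP => ker0.
have v0 : nz_row (kermx M) != 0 by rewrite nz_row_eq0.
have /sub_kermxP vM : (nz_row (kermx M) <= kermx M)%MS by exact: nz_row_sub.
have := pM (nz_row (kermx M))^T.
rewrite -(inj_eq trmx_inj) trmxK trmx0 v0 vM mul0mx mxtrace0 ltxx.
by move/(_ isT).
Qed.

Lemma psdmx_trace_ge0 n (M : 'M[R]_n) : psdmx M -> 0 <= \tr M.
Proof.
move=> [_ pM]; apply: sumr_ge0 => i _.
have := pM (delta_mx i 0).
by rewrite trmx_delta -rowE -colE trace_mx11 !mxE.
Qed.

(** An elementary substitute for the largest eigenvalue: one plus the sum of the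
    absolute values of the entries. The added one makes 1 / c a number in
    (0, 1]. *)
Lemma psdmx_scalar_bound n (M : 'M[R]_n) :
  M^T = M -> exists2 c : R, 1 <= c & psdmx (c%:M - M).
Proof.
move=> sM; exists (1 + \sum_i \sum_j `|M i j|).
  by rewrite lerDl; do 2![apply: sumr_ge0 => ? _].
split=> [|x]; first by rewrite raddfB /= tr_scalar_mx sM.
rewrite mulmxBr mulmxBl raddfB /= subr_ge0 mul_mx_scalar -scalemxAl linearZ /=.
set s := \tr (x^T *m x).
have sE : s = \sum_k x k 0 ^+ 2.
  by rewrite /s trace_mx11 mxE; apply: eq_bigr => k _; rewrite mxE expr2.
have xs k : x k 0 ^+ 2 <= s.
  by rewrite sE (bigD1 k) //= lerDl sumr_ge0 // => i _; exact: sqr_ge0.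
have s0 : 0 <= s by rewrite sE sumr_ge0 // => i _; exact: sqr_ge0.
have -> : \tr (x^T *m M *m x) = \sum_j \sum_i x i 0 * M i j * x j 0.
  rewrite trace_mx11 mxE; apply: eq_bigr => j _; rewrite mxE mulr_suml.
  by apply: eq_bigr => i _; rewrite !mxE.
rewrite exchange_big mulrDl mul1r ler_wpDl // mulr_suml ler_sum // => i _.
rewrite mulr_suml ler_sum // => j _.
apply: le_trans (ler_norm _) _; rewrite mulrAC normrM mulrC ler_wpM2l //.
(* 2 |x_i x_j| <= x_i^2 + x_j^2 <= 2 s *)
rewrite ler_norml; have := xs i; have := xs j; nra.
Qed.

(** A lower bound on Q follows from an upper bound on its inverse:
    (Q^-1 / c - 1) Q (Q^-1 / c - 1)' >= 0 expands to
    Q >= 2 / c - Q^-1 / c^2, and Q^-1 <= c turns this into Q >= 1 / c. Together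
    with X <= d, this gives Q >= X / (c d). *)
Lemma pdmx_dominates n (Q X : 'M[R]_n) : pdmx Q -> psdmx X ->
  exists2 e : R, 0 < e <= 1 & psdmx (Q - e *: X).
Proof.
move=> pQ [sX _]; have uQ := pdmx_unit pQ; have [sQ _] := pQ.
have sP : (invmx Q)^T = invmx Q by rewrite trmx_inv sQ.
have [c c1 pc] := psdmx_scalar_bound sP.
have [d d1 pd] := psdmx_scalar_bound sX.
have c0 : 0 < c by lra.
have d0 : 0 < d by lra.
exists (c^-1 * d^-1).
  by rewrite mulr_gt0 ?invr_gt0 //= mulr_ile1 ?invr_ge0 ?invf_le1 // ltW.
have pK := psdmx_congr (c^-1 *: invmx Q - 1%:M) (pdmx_psd pQ).
have c20 : 0 <= c^-1 ^+ 2 by exact: sqr_ge0.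
have e0 : 0 <= c^-1 * d^-1 by rewrite ltW // mulr_gt0 ?invr_gt0.
have := psdmxD pK (psdmxD (psdmxZ c20 pc) (psdmxZ e0 pd)).
congr psdmx; rewrite raddfB /= linearZ /= sP trmx1.
rewrite !mulmxBl !mulmxBr -!scalemxAl -!scalemxAr mulVmx // !mul1mx !mulmx1 mulmxV //.
rewrite -[c%:M]scalemx1 -[d%:M]scalemx1.
move: (invmx Q) (1%:M) => P I; apply/matrixP => i j; rewrite !mxE.
by field; rewrite !gt_eqF.
Qed.

End PositiveSemidefinite.

(** * Order properties of the Riccati map *)

Section RiccatiOrder.
Context {R : realType} {n p : nat}.
Variables (A : 'M[R]_n) (C : 'M[R]_(p, n)) (Q : 'M[R]_n) (V : 'M[R]_p).
Hypotheses (hQ : pdmx Q) (hV : pdmx V).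
Implicit Types (q t : R) (X Y : 'M[R]_n) (K : 'M[R]_(n, p)).

(** The covariance update when the measurement arrives with probability q and
    is then filtered with an arbitrary gain K (Joseph form). For fixed K it is
    affine in X, and monotone when q lies in [0, 1]. *)
Definition riccati_gain q K X : 'M[R]_n :=
  (1 - q) *: (A *m X *m A^T)
  + q *: ((A - K *m C) *m X *m (A - K *m C)^T + K *m V *m K^T) + Q.

Definition kalman_gain X : 'M[R]_(n, p) :=
  A *m X *m C^T *m invmx (C *m X *m C^T + V).

Lemma innovation_pd X : psdmx X -> pdmx (C *m X *m C^T + V).
Proof. by move=> pX; apply: psd_pdmxD => //; exact: psdmx_congr. Qed.

(** The update with gain K is a quadratic polynomial in K with leading term
    q K W K', where W = C X C' + V; completing the square shows that, for
    q >= 0, the Riccati map is its minimum over K. *)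
Lemma riccati_complete_square q K X : psdmx X ->
  riccati_gain q K X = riccati A C Q V q X
    + q *: ((K - kalman_gain X) *m (C *m X *m C^T + V)
            *m (K - kalman_gain X)^T).
Proof.
move=> pX; have pW := innovation_pd pX; have uW := pdmx_unit pW.
have [sX _] := pX; have [sW _] := pW.
rewrite /riccati_gain /riccati /kalman_gain.
set W := C *m X *m C^T + V in uW sW *.
have KWK : K *m W *m K^T = K *m C *m X *m C^T *m K^T + K *m V *m K^T.
  by rewrite mulmxDr mulmxDl !mulmxA.
have KT : (A *m X *m C^T *m invmx W)^T = invmx W *m (C *m X *m A^T).
  by rewrite !trmx_mul trmxK trmx_inv sW sX !mulmxA.
rewrite !(raddfB (@trmx _ _ _)) /= KT !trmx_mul.
rewrite !mulmxBl !mulmxBr !mulmxA.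
rewrite (mulmxKV uW) (mulmxK uW) KWK.
(* With the matrix products abstracted, the identity is linear and can be
   checked entry by entry. *)
move: (A *m X *m A^T) (A *m X *m C^T *m K^T) (K *m C *m X *m A^T)
  (K *m C *m X *m C^T *m K^T) (K *m V *m K^T)
  (A *m X *m C^T *m invmx W *m C *m X *m A^T) => a b c d e f.
by apply/matrixP => i j; rewrite !mxE; ring.
Qed.

Lemma riccati_eq_gain q X : psdmx X ->
  riccati A C Q V q X = riccati_gain q (kalman_gain X) X.
Proof.
by move=> pX; rewrite riccati_complete_square // subrr !mul0mx scaler0 addr0.
Qed.

Lemma riccati_le_gain q K X : 0 <= q -> psdmx X ->
  psdmx (riccati_gain q K X - riccati A C Q V q X).
Proof.
move=> q0 pX; rewrite riccati_complete_square // addrC addKr.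
by apply: psdmxZ => //; apply/psdmx_congr/pdmx_psd/innovation_pd.
Qed.

(** Freeze the gain K at the optimal one for Y: it is suboptimal for X, and the
    update with frozen gain is monotone. *)
Lemma riccati_mono q X Y : 0 <= q <= 1 -> psdmx X -> psdmx (Y - X) ->
  psdmx (riccati A C Q V q Y - riccati A C Q V q X).
Proof.
move=> /andP[q0 q1] pX pYX.
have pY : psdmx Y by rewrite -(subrK X Y); exact: psdmxD.
rewrite (riccati_eq_gain q pY); set K := kalman_gain Y.
have q1' : 0 <= 1 - q by rewrite subr_ge0.
have := psdmxD (riccati_le_gain K q0 pX)
  (psdmxD (psdmxZ q1' (psdmx_congr A pYX))
          (psdmxZ q0 (psdmx_congr (A - K *m C) pYX))).
congr psdmx; rewrite /riccati_gain !(mulmxBr _ Y) !(mulmxBl (_ *m Y)).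
move: (riccati _ _ _ _ _ _) (_ *m X *m _) (_ *m X *m _) (_ *m Y *m _)
  (_ *m Y *m _) (_ *m V *m _) => f a b c d e.
by apply/matrixP => i j; rewrite !mxE; ring.
Qed.

(** Freeze the gain K at the optimal one for t X. The update with this gain is
    affine, so at t X it is t times its value at X, which is at least g_q(X),
    plus 1 - t times its value at 0, which is Q + q K V K' >= Q. *)
Lemma riccati_sub_homogeneous q t X : 0 <= q -> 0 <= t <= 1 -> psdmx X ->
  psdmx (riccati A C Q V q (t *: X)
         - (t *: riccati A C Q V q X + (1 - t) *: Q)).
Proof.
move=> q0 /andP[t0 t1] pX.
rewrite (riccati_eq_gain q (psdmxZ t0 pX)); set K := kalman_gain _.
have t1' : 0 <= (1 - t) * q by rewrite mulr_ge0 // subr_ge0.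
have := psdmxD (psdmxZ t0 (riccati_le_gain K q0 pX))
  (psdmxZ t1' (psdmx_congr K (pdmx_psd hV))).
congr psdmx; rewrite /riccati_gain -!scalemxAr -!scalemxAl.
move: (riccati _ _ _ _ _ _) (_ *m X *m _) (_ *m X *m _) (_ *m V *m _)
  => f a b c.
by apply/matrixP => i j; rewrite !mxE; ring.
Qed.

(** The correction term that q multiplies is L W L' for the Kalman gain L and
    the innovation covariance W, hence positive semidefinite. *)
Lemma riccati_antitone_rate q1 q2 X : q1 <= q2 -> psdmx X ->
  psdmx (riccati A C Q V q1 X - riccati A C Q V q2 X).
Proof.
move=> q12 pX; have pW := innovation_pd pX; have uW := pdmx_unit pW.
have [sX _] := pX; have [sW _] := pW.
have q12' : 0 <= q2 - q1 by rewrite subr_ge0.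
have := psdmxZ q12' (psdmx_congr (kalman_gain X) (pdmx_psd pW)).
congr psdmx; rewrite /riccati /kalman_gain mulmxKV //.
rewrite !trmx_mul trmxK trmx_inv sW sX !mulmxA.
move: (A *m X *m A^T) (_ *m A^T) => a b.
by apply/matrixP => i j; rewrite !mxE; ring.
Qed.

(** Better observation rates give smaller fixed points, by the contraction of
    the defect 1 - t in t X2 <= X1. *)
Lemma riccati_fixpoint_antitone q1 q2 X1 X2 : 0 <= q1 -> q1 <= q2 <= 1 ->
  riccati_fixpoint A C Q V q1 X1 -> riccati_fixpoint A C Q V q2 X2 ->
  psdmx (X1 - X2).
Proof.
move=> q10 /andP[q12 q21] [pX1 fX1] [pX2 fX2].
have q20 : 0 <= q2 by exact: le_trans q12.
have q2P : 0 <= q2 <= 1 by rewrite q20.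
have [e /andP[e0 e1] pQe] := pdmx_dominates hQ pX2.
pose d := 1 - e.
have [d0 d1] : 0 <= d /\ d < 1 by rewrite /d; lra.
have pow k : psdmx (X1 - (1 - d ^+ k) *: X2).
  (* At k = 0 the claim is 0 <= X1. *)
  elim: k => [|k IH]; first by rewrite expr0 subrr scale0r subr0.
  have dk0 : 0 <= d ^+ k by exact: exprn_ge0.
  have tP : 0 <= 1 - d ^+ k <= 1.
    by rewrite subr_ge0 exprn_ile1 //= ?lerBlDr ?lerDl // ltW.
  have /andP[t0 _] := tP.
  have p1 := riccati_antitone_rate q12 pX1.
  have p2 := riccati_mono q2P (psdmxZ t0 pX2) IH.
  have p3 := riccati_sub_homogeneous q20 tP pX2.
  have p4 := psdmxZ dk0 pQe.
  (* p1 to p4 are the four inequalities of the chain, with t = 1 - d^k; their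
     sum telescopes. *)
  rewrite -fX1 in p1; rewrite -fX2 in p3.
  have := psdmxD (psdmxD p1 p2) (psdmxD p3 p4).
  congr psdmx; move: (riccati _ _ _ _ _ _) (riccati _ _ _ _ _ _) => f g.
  by apply/matrixP => i j; rewrite !mxE exprS /d; ring.
split=> [|x]; first by rewrite raddfB /= pX1.1 pX2.1.
set b := \tr (x^T *m X2 *m x).
rewrite mulmxBr mulmxBl raddfB /= -/b.
set a := \tr (x^T *m X1 *m x).
have abk k : (1 - d ^+ k) * b <= a.
  have := (pow k).2 x.
  by rewrite mulmxBr mulmxBl raddfB /= -scalemxAr -scalemxAl linearZ /= subr_ge0.
have lim : ((fun k : nat => (1 - d ^+ k) * b) @ \oo --> b)%classic.
  rewrite -[X in (_ --> X)%classic]mul1r; apply: cvgMl.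
  rewrite -[X in (_ --> X)%classic]subr0; apply: cvgB; first exact: cvg_cst.
  by apply: cvg_expr; rewrite ger0_norm.
rewrite subr_ge0 -(cvg_lim _ lim) //; apply: limr_le.
  exact: cvgP lim.
by near=> k; exact: abk.
Unshelve. all: by end_near.
Qed.

Lemma trace_riccati_sol_antitone q1 q2 : 0 <= q1 -> q1 <= q2 <= 1 ->
  (exists X, riccati_fixpoint A C Q V q1 X) ->
  (exists X, riccati_fixpoint A C Q V q2 X) ->
  \tr (riccati_sol A C Q V q2) <= \tr (riccati_sol A C Q V q1).
Proof.
move=> q10 q12 ex1 ex2; rewrite -subr_ge0 -(raddfB (@mxtrace _ _)) /=.
apply: psdmx_trace_ge0.
by apply: (riccati_fixpoint_antitone q10 q12); apply: xgetPex.
Qed.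

End RiccatiOrder.

(** * Convexity of the feasible set and of the sublevel sets *)

Lemma op_objective_le (R : realType) (N : nat) (n p : 'I_N.+1 -> nat)
    (A : forall i, 'M[R]_(n i)) (C : forall i, 'M[R]_(p i, n i))
    (Q : forall i, 'M[R]_(n i)) (V : forall i, 'M[R]_(p i))
    (q : 'rV[R]_N.+1) (a : R) :
  (op_objective A C Q V q <= a) <-> (forall i, op_trace A C Q V q i <= a).
Proof.
split=> [le_a i|le_a]; last exact: bigmax_le.
by apply: le_trans le_a; rewrite /op_objective; exact: le_bigmax.
Qed.

(** Quasi-concavity of the identity on the line; it handles the lower bounds of
    the feasible set as well as the comparison of traces. *)
Lemma min_le_convex (R : realType) (t x y : R) : 0 <= t <= 1 ->
  Num.min x y <= t * x + (1 - t) * y.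
Proof. by case/andP=> t0 t1; rewrite /Num.min; case: ifPn => ?; nra. Qed.

Lemma op_feasible_convex (R : realType) (N : nat) (qc : 'I_N.+1 -> R)
    (x y : 'rV[R]_N.+1) (t : R) : 0 <= t <= 1 ->
  op_feasible qc x -> op_feasible qc y ->
  op_feasible qc (t *: x + (1 - t) *: y).
Proof.
move=> tP [sx bx] [sy b_y]; split=> [|i].
  under eq_bigr do rewrite !mxE.
  by rewrite big_split /= -!mulr_sumr sx sy; ring.
have /andP[lx ux] := bx i; have /andP[ly uy] := b_y i.
have /andP[t0 t1] := tP.
rewrite !mxE (lt_le_trans _ (min_le_convex _ _ tP)) ?lt_min ?lx //=.
nra.
Qed.

Theorem corollary10 (R : realType) (N : nat) (n p : 'I_N.+1 -> nat)
    (A : forall i : 'I_N.+1, 'M[R]_(n i))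
    (C : forall i : 'I_N.+1, 'M[R]_(p i, n i))
    (Q : forall i : 'I_N.+1, 'M[R]_(n i))
    (V : forall i : 'I_N.+1, 'M[R]_(p i))
    (qc : 'I_N.+1 -> R)
    (hQ : forall i, pdmx (Q i))
    (hV : forall i, pdmx (V i))
    (hctrl : forall i, controllable (A i) (sqrtmx (Q i)))
    (hdet : forall i, detectable (A i) (C i))
    (hqc : forall i, is_critical_value (A i) (C i) (Q i) (V i) (qc i))
    (hsum : \sum_i qc i < 1) :
  quasiconvex_problem (op_feasible qc) (op_objective A C Q V).
Proof.
split=> [x y t|a x y t].
  rewrite !inE => fx fy; apply: op_feasible_convex fx fy.
  by rewrite ge0 le1.
rewrite !inE => -[fx /op_objective_le ax] [fy /op_objective_le ay].
have tP : 0 <= t%:num <= 1 by rewrite ge0 le1.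
have fz := op_feasible_convex tP fx fy.
split=> //; apply/op_objective_le => i.
have [/andP[qc0 _] hex] := hqc i.
have /andP[lz uz] := fz.2 i.
(* Any feasible rate r below the i-th coordinate of the combination that meets
   the bound a forces the combination to meet it too; r will be the smaller of
   x_i and y_i. *)
have anti r : qc i < r <= 1 -> r <= (t%:num *: x + (1 - t%:num) *: y) 0 i ->
    \tr (riccati_sol (A i) (C i) (Q i) (V i) r) <= a ->
    op_trace A C Q V (t%:num *: x + (1 - t%:num) *: y) i <= a.
  move=> /andP[lr ur] rz; apply: le_trans.
  have r0 : 0 < r by exact: le_lt_trans lr.
  apply: trace_riccati_sol_antitone => //; first exact: ltW.
  - by rewrite rz.
  - by apply/hex => //; rewrite r0.
  - by apply/hex => //; rewrite uz (lt_le_trans r0).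
have := min_le_convex (x 0 i) (y 0 i) tP.
have [_|_] := leP (x 0 i) (y 0 i) => le_z.
- by apply: (anti (x 0 i)) => //; [exact: fx.2|rewrite !mxE|exact: ax].
- by apply: (anti (y 0 i)) => //; [exact: fy.2|rewrite !mxE|exact: ay].
Qed.
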